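(* Let $s$ be a positive integer and let $G$ be a connected graph on $n$ vertices with $n\ge 2s+3$ and $D(G;s)=n-2s$. Then $W(G)\le W(T^{s+1}_n)$, and equality holds if and only if $G\cong T^{s+1}_n$.
   Context: All graphs are finite, simple and undirected. For a connected graph $G$, $d(u,v)$ denotes the length of a shortest $u$–$v$ path. The Wiener index is $W(G)=\sum_{\{u,v\}\subseteq V(G)} d(u,v)$, the sum over all unordered pairs of distinct vertices. For nonempty $V_1,V_2\subseteq V(G)$, $d(V_1,V_2)=\min\{d(x,y): x\in V_1, y\in V_2\}$. For a positive integer $s$, the conditional diameter is $D(G;s)=\max\{d(V_1,V_2): V_1,V_2\subseteq V(G),\ |V_1|=|V_2|=s\}$. For $1\le i\le n-1$, $T^{i}_n$ is the tree on $n$ vertices obtained from the path $x_1x_2\cdots x_{n-1}$ by adding one new vertex adjacent only to $x_i$. *)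

(* Defs.v *)
From mathcomp Require Import all_boot.
Set Implicit Arguments.
Unset Strict Implicit.
Unset Printing Implicit Defensive.

Record sgraph := SGraph {
  vertex :> finType;
  adj : rel vertex;
  adj_sym : symmetric adj;
  adj_irrefl : irreflexive adj
}.

Definition connected (G : sgraph) : Prop :=
  0 < #|G| /\ forall x y : G, connect (@adj G) x y.

Definition isomorphic (G H : sgraph) : Prop :=
  exists2 f : G -> H, bijective f & forall x y, adj (f x) (f y) = adj x y.

(* There is a path (without repeated vertices) with k edges from x to y. *)
Definition has_path (G : sgraph) (x y : G) (k : nat) : bool :=
  [exists p : k.-tuple G,
     [&& path (@adj G) x p, last x p == y & uniq (x :: p)]].

(* A path has fewer than #|G| edges, so the default value #|G| of the minimum
   is only taken when x and y lie in different components. *)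
Definition dist (G : sgraph) (x y : G) : nat :=
  \big[minn/#|G|]_(k < #|G| | has_path x y k) k.

(* The enumeration of the vertices selects one of (x, y) and (y, x) for each
   unordered pair of distinct vertices. *)
Definition wiener (G : sgraph) : nat :=
  \sum_(x : G) \sum_(y : G | enum_rank x < enum_rank y) dist x y.

(* All distances are at most #|G|, so the default value has no effect when
   A and B are nonempty. *)
Definition set_dist (G : sgraph) (A B : {set G}) : nat :=
  \big[minn/#|G|]_(x in A) \big[minn/#|G|]_(y in B) dist x y.

Definition cond_diam (G : sgraph) (s : nat) : nat :=
  \max_(A : {set G} | #|A| == s) \max_(B : {set G} | #|B| == s) set_dist A B.

(* T^i_n has vertex set 'I_n: the ordinal j with j.+1 < n stands for the path
   vertex x_(j+1), and the ordinal n.-1 for the vertex attached to x_i. *)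
Definition tree_arc (n i : nat) (u v : 'I_n) : bool :=
  (v.+1 < n) && (v == u.+1 :> nat)
  || [&& u.+1 < n, u.+1 == i & v.+1 == n].

Definition tree_adj (n i : nat) (u v : 'I_n) : bool :=
  tree_arc i u v || tree_arc i v u.

Lemma tree_adj_sym n i : symmetric (@tree_adj n i).
Proof. by move=> u v; rewrite /tree_adj orbC. Qed.

Lemma tree_adj_irrefl n i : irreflexive (@tree_adj n i).
Proof.
move=> u; rewrite /tree_adj orbb /tree_arc ltn_eqF // andbF /=.
by case: ltngtP => //=; rewrite andbF.
Qed.

Definition tree (n i : nat) : sgraph :=
  SGraph (@tree_adj_sym n i) (@tree_adj_irrefl n i).

(* Main.v *)
Require Import Defs.
From mathcomp Require Import all_boot zify.

(* Let d(A, B) = D = n - 2s with |A| = |B| = s, and sort the vertices by their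
   distance to A.  The levels 1, ..., D - 1 are nonempty and have at most D
   vertices in total, so at most one of them has two vertices and the others
   are singletons, hence cut vertices.  Together with D(G; s) <= D this yields
   a cut vertex r separating the remaining vertices into X and Y, with two
   neighbours of r in X, |X| = a + 1 and |Y| = b, where a, b >= s.
   Adding the vertices of a connected set one at a time bounds its distance
   sum by that of a path; this gives W(G) <= W(P_n) - ab, while
   W(T^(s+1)_n) >= W(P_n) - s(n - 2 - s), and ab >= s(n - 2 - s).
   In the equality case the growth bounds are tight, so G contains a spanning
   copy of T^(s+1)_n; distances in G are then at most those in the tree, and
   equality of the Wiener indices forces the two graphs to coincide. *)

(** * Minima over finite types with a default value *)

Lemma leq_bigminn (I : finType) (P : pred I) (F : I -> nat) d m :
  m <= d -> (forall i, P i -> m <= F i) -> m <= \big[minn/d]_(i | P i) F i.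
Proof.
move=> md mF; elim/big_rec: _ => // i k Pi mk.
by rewrite leq_min mF.
Qed.

Lemma bigminn_le (I : finType) (P : pred I) (F : I -> nat) d i :
  P i -> \big[minn/d]_(j | P j) F j <= F i.
Proof.
move=> Pi; rewrite -big_filter.
have: i \in [seq j <- index_enum I | P j] by rewrite mem_filter Pi mem_index_enum.
elim: [seq _ <- _ | _] => // j r IH; rewrite inE big_cons => /predU1P[->|/IH le_i].
  exact: geq_minl.
exact: leq_trans (geq_minr _ _) le_i.
Qed.

Lemma bigminn_le_id (I : finType) (P : pred I) (F : I -> nat) d :
  \big[minn/d]_(j | P j) F j <= d.
Proof. by elim/big_rec: _ => // i k _; apply: leq_trans; exact: geq_minr. Qed.

Lemma bigminn_attained (I : finType) (P : pred I) (F : I -> nat) d :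
  \big[minn/d]_(j | P j) F j < d ->
  exists2 i, P i & \big[minn/d]_(j | P j) F j = F i.
Proof.
apply: (@big_rec _ (fun k => k < d -> exists2 i, P i & k = F i)).
  by rewrite ltnn.
move=> i k Pi IH; rewrite /minn; case: ifP => _ kd; first by exists i.
exact: IH.
Qed.

(** * Basic properties of the distance *)

Lemma dist_le_path {G : sgraph} (x y : G) p :
  path (@adj G) x p -> last x p = y -> dist x y <= size p.
Proof.
move=> xp <-; have [q xq uq sub] := shortenP xp.
have szq : size q < #|G| by rewrite -[(size q).+1]/(size (x :: q)) -(card_uniqP uq) max_card.
apply: (@leq_trans (size q)); last by apply: uniq_leq_size; rewrite // (subseq_uniq (subseq_cons q x)).
apply: (@bigminn_le _ _ _ _ (Ordinal szq)).
by apply/existsP; exists (in_tuple q); rewrite xq eqxx.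
Qed.

(** The second hypothesis ranges over all walks, so that it can be proved by induction along them;
    [m <= #|G|] covers the default value of the minimum. *)
Lemma dist_geP {G : sgraph} (x y : G) m :
  m <= #|G| -> (forall p, path (@adj G) x p -> last x p = y -> m <= size p) ->
  m <= dist x y.
Proof.
move=> mG mp; apply: leq_bigminn => // k /existsP[p /and3P[xp /eqP px _]].
by rewrite -(size_tuple p); apply: mp.
Qed.

Lemma dist_le_card {G : sgraph} (x y : G) : dist x y <= #|G|.
Proof. exact: bigminn_le_id. Qed.

Lemma dist_lt_card {G : sgraph} (x y : G) : connected G -> dist x y < #|G|.
Proof.
case=> _ /(_ x y) /connectP[p xp ->]; have [q xq uq _] := shortenP xp.
apply: leq_ltn_trans (dist_le_path _ _ _ xq erefl) _.
by rewrite -[(size q).+1]/(size (x :: q)) -(card_uniqP uq) max_card.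
Qed.

Lemma dist_path {G : sgraph} (x y : G) : connected G ->
  exists p, [/\ path (@adj G) x p, last x p = y & size p = dist x y].
Proof.
move=> cG; have /bigminn_attained[k /existsP[p]] := dist_lt_card x y cG.
case/and3P=> xp /eqP px _ dk.
by exists p; split=> //; rewrite size_tuple /dist dk.
Qed.

Lemma distxx {G : sgraph} (x : G) : dist x x = 0.
Proof. by apply/eqP; rewrite -leqn0; apply: (dist_le_path _ _ [::]). Qed.

Lemma dist_sym {G : sgraph} (x y : G) : dist x y = dist y x.
Proof.
suff le (u v : G) : dist u v <= dist v u by apply/eqP; rewrite eqn_leq !le.
apply: dist_geP => [|p vp pu]; first exact: dist_le_card.
rewrite -[size p](size_belast v) -size_rev.
apply: dist_le_path.
  by rewrite -pu rev_path; apply: sub_path vp => a b; rewrite adj_sym.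
case: p {vp} pu => [|b p] //= pu; by rewrite rev_cons last_rcons.
Qed.

Lemma dist_triangle {G : sgraph} (x y z : G) : connected G ->
  dist x z <= dist x y + dist y z.
Proof.
move=> cG; have [p [xp pl <-]] := dist_path x y cG.
have [q [yq ql <-]] := dist_path y z cG.
rewrite -size_cat; apply: dist_le_path; first by rewrite cat_path xp pl.
by rewrite last_cat pl.
Qed.

Lemma dist_adj {G : sgraph} (x y : G) : adj x y -> dist x y <= 1.
Proof. by move=> xy; apply: (dist_le_path _ _ [:: y]); rewrite //= xy. Qed.

Lemma dist_gt0 {G : sgraph} (x y : G) : x != y -> 0 < dist x y.
Proof.
move=> xy; apply: dist_geP => [|[|//] _ /= /eqP]; last by rewrite (negPf xy).
by rewrite (cardD1 x) inE.
Qed.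

Lemma dist_ge2 {G : sgraph} (x y : G) : x != y -> ~~ adj x y -> 1 < dist x y.
Proof.
move=> xy nxy; apply: dist_geP => [|[|a [|//]]].
- by rewrite (cardD1 x) (cardD1 y) !inE eq_sym xy.
- by move=> _ /eqP; rewrite /= (negPf xy).
by rewrite /= andbT => xa ay; rewrite -ay xa in nxy.
Qed.

(** The source of lower bounds on distances: functions that grow by at most one along each edge. The
    second hypothesis covers the default value [#|G|] of [dist]. *)
Lemma dist_lipschitz {G : sgraph} (f : G -> nat) (x y : G) :
  (forall u v, adj u v -> f v <= (f u).+1) -> f y <= f x + #|G| ->
  f y <= f x + dist x y.
Proof.
move=> fL fG; rewrite -leq_subLR; apply: dist_geP => [|p xp <-].
  by rewrite leq_subLR.
rewrite leq_subLR; elim: p x {fG} xp => [|a p IH] x /=; first by rewrite addn0.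
case/andP=> xa /IH; have := fL _ _ xa; lia.
Qed.

(** * Distance sums over ordered pairs and adjacency-preserving maps *)

Definition dist_sum (G : sgraph) := \sum_(x : G) \sum_(y : G) dist x y.

(** The order of [enum_rank] splits the ordered pairs into two halves exchanged by the symmetry of
    [dist]. Sums over ordered pairs can then be split and reindexed freely. *)
Lemma dist_sum_wiener (G : sgraph) : dist_sum G = 2 * wiener G.
Proof.
rewrite mul2n -addnn {2}/wiener (exchange_big_dep xpredT) //= /wiener -big_split /=.
apply: eq_bigr => x _; rewrite (bigD1 x) //= distxx add0n.
rewrite (bigID (fun y => enum_rank x < enum_rank y)) /=; congr (_ + _).
  apply: eq_bigl => y; case: eqVneq => //= ->; by rewrite ltnn.
apply: eq_big => [y|y _]; last exact: dist_sym.
rewrite -leqNgt ltn_neqAle; congr (~~ _ && _).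
by rewrite -(inj_eq enum_rank_inj).
Qed.

(** Walks are mapped to walks; [#|G| <= #|H|] covers the case where [dist u v] is its default
    value. *)
Lemma dist_embed {G H : sgraph} (g : H -> G) (u v : H) :
  #|G| <= #|H| -> (forall u v, adj u v -> adj (g u) (g v)) ->
  dist (g u) (g v) <= dist u v.
Proof.
move=> GH gadj; apply: dist_geP => [|p up pv].
  exact: leq_trans (dist_le_card _ _) GH.
rewrite -(size_map g); apply: dist_le_path; last by rewrite last_map pv.
by rewrite path_map; apply: sub_path up.
Qed.

Lemma dist_sum_reindex {G H : sgraph} (g : H -> G) : bijective g ->
  dist_sum G = \sum_u \sum_v dist (g u) (g v).
Proof.
move=> bg; rewrite /dist_sum (reindex g) /=; last exact: onW_bij.
by apply: eq_bigr => u _; rewrite (reindex g) //=; exact: onW_bij.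
Qed.

Lemma isomorphic_dist_sum {G H : sgraph} : isomorphic G H -> dist_sum G = dist_sum H.
Proof.
case=> f bf fadj; have cGH := bij_eq_card bf.
rewrite (dist_sum_reindex _ bf); apply: eq_bigr => u _; apply: eq_bigr => v _.
apply/eqP; rewrite eqn_leq andbC dist_embed ?cGH //= => [|x y]; last by rewrite fadj.
case: (bf) => g fK gK; rewrite -{1}(fK u) -{1}(fK v).
by apply: dist_embed; rewrite ?cGH // => x y; rewrite -fadj !gK.
Qed.

(** No distance in [G] exceeds the corresponding one in [H], so equal sums make all of them equal.
    An additional edge of [G] would join the images of two vertices at distance at least 2. *)
Lemma dist_sum_embed_iso {G H : sgraph} (g : H -> G) : bijective g ->
  (forall u v, adj u v -> adj (g u) (g v)) -> dist_sum G = dist_sum H ->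
  isomorphic G H.
Proof.
move=> bg gadj; rewrite (dist_sum_reindex _ bg) /dist_sum !pair_big /= => eqT.
have cGH := bij_eq_card bg.
have le (p : H * H) : xpredT p ->
    dist (g p.1) (g p.2) <= dist p.1 p.2 ?= iff (dist (g p.1) (g p.2) == dist p.1 p.2).
  by move=> _; split; rewrite // dist_embed // cGH.
have [_] := leqif_sum le; rewrite eqT eqxx => /esym/forallP/= eqd.
case: (bg) => f gK fK; exists f; first by exists g.
suff adj_g u v : adj (g u) (g v) = adj u v by move=> x y; rewrite -adj_g !fK.
apply/idP/idP => [guv|/gadj//]; apply/negPn/negP => nuv.
have uv : u != v by apply: contraTneq guv => ->; rewrite adj_irrefl.
have := dist_ge2 _ _ uv nuv; have := dist_adj _ _ guv.
by rewrite (eqP (eqd (u, v))) /=; lia.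
Qed.

(** * Growing sets along edges, and branches at a vertex *)

Lemma grow_ind {G : sgraph} (P : {set G} -> Prop) (S0 S : {set G}) :
  (forall U : {set G}, S0 \subset U -> U \proper S ->
     exists x y, [/\ x \in S, x \notin U, y \in U & adj x y]) ->
  (forall (U : {set G}) x y, S0 \subset U -> P U -> x \notin U -> y \in U -> adj x y ->
     P (x |: U)) ->
  S0 \subset S -> P S0 -> P S.
Proof.
move=> edge step sub0 P0.
suff IH m (U : {set G}) :
    #|S :\: U| <= m -> S0 \subset U -> U \subset S -> P U -> P S by exact: (IH _ S0).
elim: m U => [|m IHm] U Um S0U US PU.
  suff ->: S = U by [].
  by apply/eqP; rewrite eqEsubset US andbT -setD_eq0 -cards_eq0 -leqn0.
have [/eqP <- //|nUS] := boolP (U == S).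
have [|x [y [xS xU yU xy]]] := edge U S0U; first by rewrite properEneq nUS.
apply: (IHm (x |: U)); last exact: step xU yU xy.
- move: Um; rewrite (cardsD1 x (S :\: U)) !inE xU xS add1n ltnS.
  by rewrite setUC -setDDl.
- by rewrite (subset_trans S0U) // subsetUr.
by rewrite subUset sub1set xS.
Qed.

(** In other words, [X] is a union of components of the graph with [r] deleted. *)
Definition branch {G : sgraph} (r : G) (X : {set G}) :=
  r \notin X /\ forall x y, x \in X -> adj x y -> y \in r |: X.

Lemma branch_compl {G : sgraph} (r : G) (X : {set G}) :
  branch r X -> branch r (~: (r |: X)).
Proof.
case=> rX Xadj; split=> [|x y]; rewrite !inE ?eqxx // negb_or.
case/andP=> xr xX xy; case: eqVneq => //= yr; apply/negP => yX.
have := Xadj y x yX; rewrite adj_sym xy => /(_ isT).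
by rewrite !inE (negPf xr) (negPf xX).
Qed.

Lemma exit_edge {G : sgraph} (Z : {set G}) (z r : G) : connected G ->
  z \in Z -> r \notin Z -> exists x y, [/\ x \in Z, y \notin Z & adj x y].
Proof.
case=> _ /(_ z r) /connectP[p]; elim: p z => [|a p IH] z /=.
  by move=> _ -> ->.
case/andP=> za ap lp zZ rZ; have [aZ|aZ] := boolP (a \in Z); first exact: (IH a).
by exists z, a.
Qed.

(** The supply of edges for [grow_ind]: an edge leaving the uncovered part must end in [U], since a
    branch can be left only through [r], which is already covered. *)
Lemma branch_edge {G : sgraph} (r : G) (X U : {set G}) : connected G ->
  branch r X -> r \in U -> U \proper r |: X ->
  exists x y, [/\ x \in r |: X, x \notin U, y \in U & adj x y].
Proof.
move=> cG [rX Xadj] rU /properP[UX [z zX zU]].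
have [|| x [y []]] := @exit_edge G ((r |: X) :\: U) z r cG; rewrite ?inE ?rU //.
  by rewrite zU; move: zX; rewrite !inE.
case/andP=> xU xrX yZ xy; exists x, y; split=> //; first by rewrite !inE.
have xX : x \in X by case/orP: xrX => // /eqP xr; rewrite xr rU in xU.
have := Xadj _ _ xX xy; rewrite !inE => yrX.
by move: yZ; rewrite yrX andbT negbK.
Qed.

(** * Transmissions and their growth bounds *)

Definition transmission {G : sgraph} (S : {set G}) (v : G) :=
  \sum_(u in S) dist v u.

(** The pairs are ordered, and distances are those of [G], not of the subgraph induced by [S]. *)
Definition dist_sum_in {G : sgraph} (S : {set G}) :=
  \sum_(v in S) transmission S v.

Lemma transmissionU1 {G : sgraph} (S : {set G}) (x v : G) : x \notin S ->
  transmission (x |: S) v = dist v x + transmission S v.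
Proof. by move=> xS; rewrite /transmission big_setU1. Qed.

Lemma dist_sum_inU1 {G : sgraph} (S : {set G}) (x : G) : x \notin S ->
  dist_sum_in (x |: S) = dist_sum_in S + 2 * transmission S x.
Proof.
move=> xS; rewrite /dist_sum_in big_setU1 //= transmissionU1 // distxx add0n.
under eq_bigr => v _ do rewrite transmissionU1 // dist_sym.
by rewrite big_split /= -/(transmission S x); lia.
Qed.

Lemma transmission_step {G : sgraph} (S : {set G}) (x y : G) : connected G ->
  adj x y -> transmission S x <= #|S| + transmission S y.
Proof.
move=> cG xy; rewrite -sum1_card /transmission -big_split /=.
apply: leq_sum => u _; apply: leq_trans (dist_triangle x y u cG) _.
by rewrite leq_add2r dist_adj.
Qed.

(* The value k(k^2 - 1)/3 of a path on k vertices, with no subtraction. *)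
Lemma dist_sum_in_branch {G : sgraph} (r : G) (X : {set G}) : connected G ->
  branch r X -> 3 * dist_sum_in (r |: X) + #|r |: X| <= #|r |: X| ^ 3.
Proof.
move=> cG bX.
(* With k = [#|U|], distances stay below k and transmissions are at most k(k - 1)/2. A new vertex
   then adds at most k(k + 1) to the sum, which is the growth of k(k^2 - 1)/3. *)
pose P (U : {set G}) := [/\ forall v u, v \in U -> u \in U -> dist v u < #|U|,
  forall v, v \in U -> 2 * transmission U v + #|U| <= #|U| ^ 2 &
  3 * dist_sum_in U + #|U| <= #|U| ^ 3].
suff [] : P (r |: X) by [].
apply: (grow_ind P [set r]) => [U|U x y||].
- by rewrite sub1set; exact: branch_edge.
- move=> _ [dU tU sU] xU yU xy; have := transmission_step U x y cG xy.
  move: (tU y yU) => tUy tx; rewrite /P cardsU1 xU.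
  have dx v : v \in U -> dist x v <= #|U|.
    move=> vU; apply: leq_trans (dist_triangle x y v cG) _.
    by have := dist_adj x y xy; have := dU y v yU vU; clear; lia.
  split=> [v u|v|].
  + rewrite !inE => /predU1P[->|vU] /predU1P[->|uU]; rewrite ?distxx //.
    * by rewrite add1n ltnS dx.
    * by rewrite add1n ltnS dist_sym dx.
    by rewrite ltnW // add1n ltnS dU.
  + rewrite transmissionU1 // !inE => /predU1P[->|vU].
      by rewrite distxx; move: tx tUy; clear; lia.
    by have := tU v vU; have := dx v vU; rewrite dist_sym; clear; lia.
  by rewrite dist_sum_inU1 //; move: tx tUy sU; clear; lia.
- by rewrite sub1set setU11.
rewrite /P /dist_sum_in /transmission cards1 big_set1 big_set1 distxx; split=> //.
  by move=> v u /set1P-> /set1P->; rewrite distxx.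
by move=> v /set1P->; rewrite big_set1 distxx.
Qed.


(** Any other vertex is reached by a proper prefix of the walk, hence at a distance below
    [size p]. *)
Lemma dist_eq_last {G : sgraph} (r : G) p y :
  path (@adj G) r p -> y \in r :: p -> size p <= dist r y -> y = last r p.
Proof.
move=> + yp; have [p1 p2 yl] := splitPl yp; case: p2 => [|b p2].
  by rewrite cats0 yl.
rewrite cat_path size_cat /= => /andP[rp1 _].
by have := dist_le_path _ _ _ rp1 yl; lia.
Qed.

(** Growing from [r], the vertex that joins k others is at distance at most k from [r], so the
    transmission is at most 1 + 2 + ... Equality requires each new vertex to prolong a path at its
    far end. *)
Lemma transmission_branch {G : sgraph} (r : G) (Y : {set G}) : connected G ->
  branch r Y ->
  2 * transmission (r |: Y) r + #|r |: Y| <= #|r |: Y| ^ 2 /\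
  (2 * transmission (r |: Y) r + #|r |: Y| = #|r |: Y| ^ 2 ->
   exists p, [/\ path (@adj G) r p, uniq (r :: p) & r |: Y =i r :: p]).
Proof.
move=> cG bY.
pose P (U : {set G}) := [/\ forall u, u \in U -> dist r u < #|U|,
  2 * transmission U r + #|U| <= #|U| ^ 2 &
  2 * transmission U r + #|U| = #|U| ^ 2 ->
   exists p, [/\ path (@adj G) r p, uniq (r :: p) & U =i r :: p]].
suff [] : P (r |: Y) by [].
apply: (grow_ind P [set r]) => [U|U x y||].
- by rewrite sub1set; exact: branch_edge.
- move=> _ [dU tU pU] xU yU xy; rewrite /P cardsU1 xU transmissionU1 //.
  have dx : dist r x <= (dist r y).+1.
    apply: leq_trans (dist_triangle r y x cG) _.
    by rewrite -addn1 leq_add2l dist_adj // adj_sym.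
  have dy := dU y yU; split=> [u||tE].
  + rewrite add1n ltnS !inE => /predU1P[->|/dU/ltnW//]; exact: leq_trans dx dy.
  + by move: tU dx dy; clear; lia.
  (* Equality for the larger set forces equality for [U] and the largest possible distance for [y],
     which is thus the end of the path. *)
  have [|p [rp up Up]] := pU; first by move: tE tU dx dy; clear; lia.
  have szp : #|U| = (size p).+1 by rewrite (eq_card Up) (card_uniqP up).
  have yl : y = last r p.
    by apply: dist_eq_last; rewrite -?Up //; move: szp tE tU dx dy; clear; lia.
  exists (rcons p x); rewrite rcons_path rp -yl [adj y x]adj_sym xy; split=> //.
    by rewrite -rcons_cons rcons_uniq up -Up xU.
  by move=> u; rewrite !inE mem_rcons Up !inE orbCA.
- by rewrite sub1set setU11.
rewrite /P /transmission cards1 big_set1 distxx; split=> // [u /set1P->|_].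
  by rewrite distxx.
by exists [::]; split=> // u; rewrite !inE.
Qed.

(* The extremal case is a path on k = #|r |: X| vertices whose second vertex is
   r: the transmission is 1 + (1 + ... + (k - 2)). *)
Lemma transmission_fork {G : sgraph} (r c1 c2 : G) (X : {set G}) :
  connected G -> branch r X ->
  c1 \in X -> c2 \in X -> c1 != c2 -> adj r c1 -> adj r c2 ->
  2 * transmission (r |: X) r + 3 * #|r |: X| <= #|r |: X| ^ 2 + 4 /\
  (2 * transmission (r |: X) r + 3 * #|r |: X| = #|r |: X| ^ 2 + 4 ->
   exists w p, [/\ adj r w, path (@adj G) r p, uniq (w :: r :: p) &
                   r |: X =i w :: r :: p]).
Proof.
move=> cG bX c1X c2X c12 rc1 rc2.
(* The two neighbours share the distance 1, so distances from [r] are at most [#|U|] - 2, one less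
   than for a path grown from [r]. *)
pose P (U : {set G}) := [/\ forall u, u \in U -> (dist r u).+1 < #|U|,
  2 * transmission U r + 3 * #|U| <= #|U| ^ 2 + 4 &
  2 * transmission U r + 3 * #|U| = #|U| ^ 2 + 4 ->
   exists w p, [/\ adj r w, path (@adj G) r p, uniq (w :: r :: p) &
                   U =i w :: r :: p]].
have [rX _] := bX.
have c1r : c1 != r by apply: contraNneq rX => <-.
have c2r : c2 != r by apply: contraNneq rX => <-.
have rS : r \notin [set c1; c2] by rewrite !inE eq_sym (negPf c1r) eq_sym.
have cS : #|r |: [set c1; c2]| = 3 by rewrite cardsU1 rS cards2 c12.
have d1 : dist r c1 = 1.
  by apply/eqP; rewrite eqn_leq dist_adj // dist_gt0 // eq_sym.
have d2 : dist r c2 = 1.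
  by apply/eqP; rewrite eqn_leq dist_adj // dist_gt0 // eq_sym.
suff [] : P (r |: X) by [].
apply: (grow_ind P (r |: [set c1; c2])) => [U|U x y||].
- by rewrite subUset sub1set => /andP[rU _]; exact: branch_edge.
- move=> /subset_leq_card; rewrite cS => U3.
  move=> [dU tU pU] xU yU xy; rewrite /P cardsU1 xU transmissionU1 //.
  have dx : dist r x <= (dist r y).+1.
    apply: leq_trans (dist_triangle r y x cG) _.
    by rewrite -addn1 leq_add2l dist_adj // adj_sym.
  have dy := dU y yU; split=> [u||tE].
  + rewrite add1n ltnS !inE => /predU1P[->|/dU/ltnW//]; exact: leq_ltn_trans dx dy.
  + by move: tU dx dy; clear; lia.
  have [|w [p [rw rp up Up]]] := pU; first by move: tE tU dx dy; clear; lia.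
  have szp : #|U| = (size p).+2 by rewrite (eq_card Up) (card_uniqP up).
  have ydist : size p <= dist r y by move: szp tE tU dx dy; clear; lia.
  move: yU; rewrite Up inE => /predU1P[yw|yp].
    (* If the new vertex hangs on the short arm [w], then [p] is a single vertex [c], and the two
       arms exchange their roles. *)
    have := dist_adj _ _ rw; rewrite -yw => d1y.
    have: size p == 1 by rewrite eqn_leq (leq_trans ydist d1y) -2!ltnS -szp.
    case: p => [|c [|? ?]] //= in rp up Up szp ydist * => _.

    have wx : adj w x by rewrite adj_sym -yw.
    case/andP: rp => rc _; exists c, [:: w; x]; rewrite /= rw wx; split=> //.
      move: xU up; rewrite Up !inE !negb_or [c == r]eq_sym [w == r]eq_sym [w == c]eq_sym.
      by rewrite [x == w]eq_sym [x == r]eq_sym [x == c]eq_sym; do !case: eqP.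
    by move=> u; rewrite !inE Up !inE; do !case: eqP.
  have yl : y = last r p by apply: dist_eq_last.
  exists w, (rcons p x); rewrite rcons_path rp -yl [adj y x]adj_sym xy; split=> //.
    rewrite -rcons_cons -(rcons_cons w) rcons_uniq up -Up xU //.
  by move=> u; rewrite !inE mem_rcons Up !inE; do !case: eqP.
- by rewrite setUS // subUset !sub1set c1X.
rewrite /P cS transmissionU1 // /transmission distxx big_setU1 ?inE //= big_set1.
rewrite d1 d2; split=> // [u|_].
  by rewrite !inE => /or3P[] /eqP->; rewrite ?distxx ?d1 ?d2.
exists c1, [:: c2]; split=> //=; first by rewrite rc2.
  by rewrite !inE (negPf c1r) (negPf c12) eq_sym c2r.
by move=> u; rewrite !inE orbCA.
Qed.

(** * Combining the two sides of a cut vertex *)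

Lemma dist_sum_cut {G : sgraph} (r : G) (X : {set G}) (Y := ~: (r |: X)) :
  connected G -> r \notin X ->
  dist_sum G <= dist_sum_in (r |: X) + dist_sum_in (r |: Y)
    + 2 * (#|Y| * transmission (r |: X) r + #|X| * transmission (r |: Y) r).
Proof.
move=> cG rX; have rY : r \notin Y by rewrite !inE eqxx.
have tY : transmission (r |: Y) r = transmission Y r.
  by rewrite transmissionU1 // distxx.
rewrite [dist_sum_in (r |: Y)]dist_sum_inU1 // tY; set X' := r |: X.
pose E := \sum_(x in X') \sum_(y in Y) dist x y.
have splitS (S : {set G}) : \sum_(x in S) \sum_y dist x y =
    \sum_(x in S) \sum_(y in X') dist x y + \sum_(x in S) \sum_(y in Y) dist x y.
  rewrite -big_split /=; apply: eq_bigr => x _.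
  by rewrite (bigID (mem X')) /=; congr (_ + _); apply: eq_bigl => y; rewrite in_setC.
have -> : dist_sum G = dist_sum_in X' + 2 * E + dist_sum_in Y.
  rewrite /dist_sum (bigID (mem X')) /= splitS.
  rewrite [X in _ + X = _](eq_bigl (fun x => x \in Y)) => [|x]; last by rewrite in_setC.
  rewrite splitS [X in _ + _ + (X + _)]exchange_big /=.
  rewrite (_ : \sum_(i in X') \sum_(j in Y) dist j i = E); last first.
    by apply: eq_bigr => i _; apply: eq_bigr => j _; rewrite dist_sym.
  rewrite -/E -/(dist_sum_in X'); rewrite /dist_sum_in /transmission; lia.
have leE : E <= #|Y| * transmission X' r + #|X'| * transmission Y r.
  have -> : #|Y| * transmission X' r + #|X'| * transmission Y r =
      \sum_(x in X') \sum_(y in Y) (dist x r + dist r y).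
    rewrite (eq_bigr (fun x => #|Y| * dist x r + transmission Y r)).
      rewrite big_split /= -big_distrr sum_nat_const /=; congr (_ * _ + _).
      by apply: eq_bigr => x _; rewrite dist_sym.
    by move=> x _; rewrite big_split /= sum_nat_const.
  apply: leq_sum => x _; apply: leq_sum => y _; exact: dist_triangle.
(* Since [X'] has one vertex more than [X], one copy of [transmission Y r] is left over; doubled, it
   turns [dist_sum_in Y] into [dist_sum_in (r |: Y)]. *)
move: leE; rewrite [#|X'|]cardsU1 rX; clear; lia.
Qed.

(* The bound is n^3 - n - 6ab, six times W(P_n) - ab. *)
Lemma dist_sum_fork {G : sgraph} (r c1 c2 : G) (X : {set G}) a b :
  connected G -> branch r X -> c1 \in X -> c2 \in X -> c1 != c2 ->
  adj r c1 -> adj r c2 -> #|X| = a.+1 -> #|~: (r |: X)| = b ->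
  3 * dist_sum G + (a + b + 2) + 6 * (a * b) <= (a + b + 2) ^ 3 /\
  (0 < b -> 3 * dist_sum G + (a + b + 2) + 6 * (a * b) = (a + b + 2) ^ 3 ->
   exists w p q, [/\ adj r w, path (@adj G) r p, path (@adj G) r q,
     uniq (w :: r :: q ++ p) & size p = b /\ size q = a]).
Proof.
move=> cG bX c1X c2X c12 rc1 rc2 cX cY.
have [rX _] := bX; have bY := branch_compl _ _ bX.
have := dist_sum_cut r X cG rX.
have := dist_sum_in_branch r X cG bX; have := dist_sum_in_branch r _ cG bY.
have [tY eY] := transmission_branch r _ cG bY.
have [tX eX] := transmission_fork r c1 c2 X cG bX c1X c2X c12 rc1 rc2.
move: tX tY eX eY; set Y := ~: _ in cY *.
have rY : r \notin Y by rewrite !inE eqxx.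
have cX' : #|r |: X| = a.+2 by rewrite cardsU1 rX cX.
have cY' : #|r |: Y| = b.+1 by rewrite cardsU1 rY cY.
rewrite cX' cY' cX cY.
move: (transmission (r |: X) r) (transmission (r |: Y) r).
move: (dist_sum_in (r |: X)) (dist_sum_in (r |: Y)) (dist_sum G).
move=> sX sY t tX tY leX leY eX eY leSY leSX le.
(* The transmission bounds, multiplied by the weights they carry in the cut bound; the rest is then
   linear in these products. *)
have mX : b * (2 * tX + 3 * a.+2) <= b * (a.+2 ^ 2 + 4) by rewrite leq_mul2l leX orbT.
have mY : a.+1 * (2 * tY + b.+1) <= a.+1 * b.+1 ^ 2 by rewrite leq_mul2l leY orbT.
split=> [|b0 eq]; first by move: mX mY leSX leSY le; clear; lia.
have /eX[w [q [rw rq uq Xq]]] : 2 * tX + 3 * a.+2 = a.+2 ^ 2 + 4.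
  apply/eqP; rewrite -(eqn_pmul2l b0) eqn_leq mX /=.
  by move: mY leSX leSY le eq; clear; lia.
have /eY[p [rp up Yp]] : 2 * tY + b.+1 = b.+1 ^ 2.
  apply/eqP; rewrite -(eqn_pmul2l (ltn0Sn a)) eqn_leq mY /=.
  by move: mX leSX leSY le eq; clear; lia.
have pX y : y \in p -> y \notin r |: X.
  move=> yp; have : y \in r |: Y by rewrite Yp inE yp orbT.
  rewrite in_setU1 in_setC.
  by case: eqVneq => //= yr; move: up; rewrite /= -yr yp.
have szq : size (w :: r :: q) = a.+2 by rewrite -cX' (eq_card Xq) (card_uniqP uq).
have szp : size (r :: p) = b.+1 by rewrite -cY' (eq_card Yp) (card_uniqP up).
exists w, p, q; split=> //; last by case: szq szp => -> [->].
rewrite -[_ :: _ :: _ ++ _]/((w :: r :: q) ++ p) cat_uniq uq.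
move: up; rewrite cons_uniq => /andP[_ ->]; rewrite andbT; apply/hasPn => y /pX; by rewrite Xq.
Qed.

(** * Distance sums of the path and of the tree *)

(** The transmission c(c + 1)/2 + m(m - 1)/2 of the point c on the path 0, ..., c + m - 1, with
    absolute differences written by truncated subtraction. For m = 0 the point lies just past the
    end. *)
Lemma sum_absdiff_point c m :
  2 * (\sum_(j < c + m) ((c - j) + (j - c))) + m = c * c.+1 + m ^ 2.
Proof.
elim: m => [|m IH]; last first.
  by rewrite [c + _]addnS big_ord_recr /=; move: IH; move: (\sum_(i < _) _) => S; lia.
rewrite !addn0; elim: c => [|c IH]; first by rewrite big_ord0.
rewrite big_ord_recl /= (eq_bigr (fun j : 'I_c => (c - j) + (j - c))).
  by move: IH; move: (\sum_(i < _) _) => S; lia.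
by move=> j _; rewrite /= /bump /=; lia.
Qed.

Lemma sum_absdiff N :
  3 * (\sum_(i < N) \sum_(j < N) ((i - j) + (j - i))) + N = N ^ 3.
Proof.
elim: N => [|N IH]; first by rewrite big_ord0.
rewrite big_ord_recr /=.
under eq_bigr => i _ do rewrite big_ord_recr /=.
rewrite big_split /= big_ord_recr /=.
have -> : \sum_(i < N) ((i - N) + (N - i)) = \sum_(i < N) ((N - i) + (i - N)).
  by apply: eq_bigr => i _; rewrite addnC.
have := sum_absdiff_point N 0; rewrite !addn0.
move: IH; move: (\sum_(i < N) \sum_(j < N) _) => A; move: (\sum_(i < N) _) => B.
by rewrite subnn; lia.
Qed.

(** Distances are bounded below by functions that grow by at most one along edges: one for pairs on
    the path, one for pairs containing the pendant vertex. *)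
Lemma tree_dist_sum_ge n s : s.+2 <= n ->
  n ^ 3 <= 3 * dist_sum (tree n s.+1) + n + 6 * (s * (n - 2 - s)).
Proof.
case: n => // N sN.
have [m Nm] : exists m, N = s + m.+1 by exists (N - s.+1); lia.
have cT : #|tree N.+1 s.+1| = N.+1 by rewrite card_ord.
(* [f] folds the pendant vertex, ordinal [N], onto its neighbour, ordinal [s]; [h] is the distance
   to the pendant vertex. *)
pose f (u : 'I_N.+1) := if u < N then nat_of_ord u else s.
pose h (u : 'I_N.+1) := if u < N then ((s - u) + (u - s)).+1 else 0.
have fL (u v : tree N.+1 s.+1) : adj u v -> f v <= (f u).+1.
  rewrite /= /tree_adj /tree_arc /f; have := ltn_ord u; have := ltn_ord v.
  by clear -sN; case: (ltnP v N); case: (ltnP u N); lia.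
have hL (u v : tree N.+1 s.+1) : adj u v -> h v <= (h u).+1.
  rewrite /= /tree_adj /tree_arc /h; have := ltn_ord u; have := ltn_ord v.
  by clear -sN; case: (ltnP v N); case: (ltnP u N); lia.
have df (u v : tree N.+1 s.+1) : (f u - f v) + (f v - f u) <= dist u v.
  have le (x y : tree N.+1 s.+1) : f y <= f x + dist x y.
    by apply: dist_lipschitz; rewrite // cT /f; have := ltn_ord y; clear -sN; case: (ltnP y N); case: (ltnP x N); lia.
  by have := le u v; have := le v u; rewrite dist_sym; clear; lia.
have dh (u v : tree N.+1 s.+1) : h v <= h u + dist u v.
  by apply: dist_lipschitz; rewrite // cT /h; have := ltn_ord v; clear -sN; case: (ltnP v N); case: (ltnP u N); lia.
have fw (i : 'I_N) : f (widen_ord (leqnSn N) i) = i by rewrite /f /= ltn_ord.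
have hw (i : 'I_N) : h (widen_ord (leqnSn N) i) = ((s - i) + (i - s)).+1.
  by rewrite /h /= ltn_ord.
have hm : h ord_max = 0 by rewrite /h /= ltnn.
pose K := \sum_(i < N) ((s - i) + (i - s)).
have leaf (x : 'I_N -> nat) :
    (forall i, x i = dist (ord_max : tree N.+1 s.+1) (widen_ord (leqnSn N) i)) ->
    K + N <= \sum_(i < N) x i.
  move=> xE; rewrite -[X in _ + X]card_ord -sum1_card -big_split /=.
  apply: leq_sum => i _; rewrite xE addn1 -hw.
  by apply: leq_trans (dh ord_max _) _; rewrite hm.
have bodyN : \sum_(i < N) \sum_(j < N) ((i - j) + (j - i)) <=
    \sum_(i < N) \sum_(j < N) dist (widen_ord (leqnSn N) i : tree N.+1 s.+1)
                                   (widen_ord (leqnSn N) j).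
  by apply: leq_sum => i _; apply: leq_sum => j _; rewrite -{1 2}fw -{1 2}(fw j).
have := sum_absdiff_point s (N - s); rewrite subnKC; last by rewrite Nm leq_addr.
rewrite -/K => KE.
rewrite /dist_sum big_ord_recr /=.
under eq_bigr => i _ do rewrite big_ord_recr /=.
rewrite big_split /= big_ord_recr /= distxx.
have := sum_absdiff N.
have := leaf _ (fun i => erefl); have := leaf _ (fun i => dist_sym _ _).
move: bodyN KE; do 4!move: (\sum_(i < N) _) => ?; clear leaf; clearbody K.
have -> : N.+1 - 2 - s = m by rewrite Nm; clear; lia.
have -> : N - s = m.+1 by rewrite Nm addKn.
by rewrite Nm; clear; lia.
Qed.

(** * Spanning copies of the tree *)

Lemma tree_spanning {G : sgraph} n s (w r : G) p q : #|G| = n ->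
  adj r w -> path (@adj G) r p -> path (@adj G) r q ->
  uniq (w :: r :: q ++ p) -> size q = s -> size p + s + 2 = n ->
  exists2 g : tree n s.+1 -> G, bijective g &
    forall u v, adj u v -> adj (g u) (g v).
Proof.
move=> cG rw rp rq uz szq szp.
(* This is the path of the tree: the [s] vertices of [q] come first, so [r] has index [s]. Appending
   [w] gives it the last ordinal, that of the pendant vertex. *)
pose z := rev q ++ r :: p.
have sz : size z = n.-1 by rewrite size_cat size_rev /= szq -szp; lia.
have n0 : n = n.-1.+1 by lia.
have uzw : uniq (rcons z w).
  rewrite (perm_uniq (_ : perm_eq _ (w :: r :: q ++ p))) //.
  rewrite perm_rcons perm_cons /z perm_catC /= perm_cons perm_catC.
  by rewrite perm_cat2r perm_rev.
have ssz : sorted (@adj G) z.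
  rewrite /z -cat_rcons -rev_cons lastI rev_rcons /= cat_path rev_path.
  rewrite (eq_path (_ : _ =2 @adj G)) => [|x y]; last by rewrite adj_sym.
  by case: q {szq uz uzw z sz} rq => [|b q] rq; rewrite rq //= rev_cons last_rcons.
pose g (u : tree n s.+1) := nth r (rcons z w) u.
have szw : size (rcons z w) = n by rewrite size_rcons sz -n0.
have arc (u v : 'I_n) : tree_arc s.+1 u v -> adj (g u) (g v).
  rewrite /g !nth_rcons sz; case/orP=> [/andP[vn /eqP vu]|/and3P[un /eqP us /eqP vn]].
    have vn' : v < n.-1 by rewrite -ltnS -n0.
    rewrite vn' ifT; last by rewrite -vu in vn' *; lia.
    by rewrite vu; have /(sortedP r) := ssz; apply; rewrite sz -vu.
  have -> : n.-1 = v by apply: succn_inj; rewrite -n0 vn.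
  rewrite ltnn eqxx ifT; last by rewrite -ltnS vn.
  by case: us => ->; rewrite nth_cat size_rev szq ltnn subnn.
exists g => [|u v]; last first.
  by rewrite /= /tree_adj => /orP[/arc //|/arc]; rewrite adj_sym.
apply: inj_card_bij; last by rewrite cG card_ord.
move=> u v /eqP; rewrite nth_uniq ?szw ?ltn_ord // => /eqP; exact: val_inj.
Qed.

(** * Levels by distance from a set *)

Definition level {G : sgraph} (A : {set G}) (v : G) :=
  \big[minn/#|G|]_(x in A) dist x v.

Lemma level_le {G : sgraph} (A : {set G}) (x v : G) :
  x \in A -> level A v <= dist x v.
Proof. by move=> xA; apply: (bigminn_le _ (mem A)). Qed.

Lemma level_lt_card {G : sgraph} (A : {set G}) (v : G) :
  connected G -> 0 < #|A| -> level A v < #|G|.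
Proof.
move=> cG /card_gt0P[x xA].
exact: leq_ltn_trans (level_le _ _ _ xA) (dist_lt_card _ _ cG).
Qed.

Lemma level_attained {G : sgraph} (A : {set G}) (v : G) :
  connected G -> 0 < #|A| -> exists2 x, x \in A & level A v = dist x v.
Proof. by move=> cG A0; apply: bigminn_attained; apply: level_lt_card. Qed.

Lemma level_adj {G : sgraph} (A : {set G}) (u v : G) :
  connected G -> 0 < #|A| -> adj u v -> level A v <= (level A u).+1.
Proof.
move=> cG A0 uv; have [x xA ->] := level_attained A u cG A0.
apply: leq_trans (level_le _ _ _ xA) (leq_trans (dist_triangle x u v cG) _).
by rewrite -addn1 leq_add2l dist_adj.
Qed.

Lemma level_eq0 {G : sgraph} (A : {set G}) (v : G) :
  connected G -> 0 < #|A| -> (level A v == 0) = (v \in A).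
Proof.
move=> cG A0; apply/idP/idP => [|vA]; last by rewrite -leqn0 -(distxx v) level_le.
have [x xA ->] := level_attained A v cG A0.
by have [<- //|/dist_gt0] := eqVneq x v; rewrite lt0n => /negPf->.
Qed.

(** [u] is the last but one vertex on a shortest path from [A] to [v]. *)
Lemma level_pred {G : sgraph} (A : {set G}) (v : G) k :
  connected G -> 0 < #|A| -> level A v = k.+1 ->
  exists2 u, adj u v & level A u = k.
Proof.
move=> cG A0 lv; have [x xA] := level_attained A v cG A0.
have [p [xp pv <-]] := dist_path x v cG; rewrite lv.
case/lastP: p xp pv => [|p w] //; rewrite rcons_path last_rcons size_rcons.
case/andP=> xp uv wv [kE]; rewrite {}wv in uv; exists (last x p) => //.
have := level_adj A _ _ cG A0 uv; rewrite lv ltnS => le; apply/eqP.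
rewrite eqn_leq le andbT kE.
exact: leq_trans (level_le _ _ _ xA) (dist_le_path _ _ _ xp erefl).
Qed.

Lemma level_inhabited {G : sgraph} (A : {set G}) (v : G) j :
  connected G -> 0 < #|A| -> j <= level A v -> exists u, level A u = j.
Proof.
move=> cG A0; move: {2}(level A v) (erefl (level A v)) => k.
elim: k v => [|k IH] v lv; first by rewrite lv leqn0 => /eqP->; exists v.
rewrite lv leq_eqVlt ltnS => /predU1P[->|jk]; first by exists v.
by have [u _ lu] := level_pred A v k cG A0 lv; apply: (IH u); rewrite ?lu.
Qed.

(** * Bounds for the conditional diameter *)

Lemma subset_of_card {T : finType} (S : {set T}) s : s <= #|S| ->
  exists2 U : {set T}, U \subset S & #|U| = s.
Proof.
move=> sS; exists [set x in take s (enum S)].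
  by apply/subsetP => x; rewrite inE => /mem_take; rewrite mem_enum.
rewrite cardsE (card_uniqP _) ?take_uniq ?enum_uniq //.
by rewrite size_take_min -cardE; apply/minn_idPl.
Qed.

(** Larger sets can be shrunk to size [s] without losing the bound; [m <= #|G|] covers the default
    values in [set_dist]. *)
Lemma cond_diam_ge {G : sgraph} (A B : {set G}) s m : m <= #|G| ->
  s <= #|A| -> s <= #|B| ->
  (forall x y, x \in A -> y \in B -> m <= dist x y) -> m <= cond_diam G s.
Proof.
move=> mG /subset_of_card[A' /subsetP sA cA] /subset_of_card[B' /subsetP sB cB] mAB.
apply: (@bigmax_sup _ A'); first exact/eqP.
apply: (@bigmax_sup _ B'); first exact/eqP.
apply: leq_bigminn => // x /sA xA; apply: leq_bigminn => // y /sB yB.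
exact: mAB.
Qed.

Lemma cond_diam_attained {G : sgraph} s : 0 < cond_diam G s ->
  exists A B : {set G}, [/\ #|A| = s, #|B| = s &
    forall x y, x \in A -> y \in B -> cond_diam G s <= dist x y].
Proof.
move=> D0; have [[A /andP[/eqP cA /existsP[B /andP[/eqP cB le]]]]|none] :=
  altP (@existsP _ (fun A : {set G} => (#|A| == s) &&
    [exists B : {set G}, (#|B| == s) && (cond_diam G s <= set_dist A B)])).
  exists A, B; split=> // x y xA yB; apply: leq_trans le _.
  apply: leq_trans (bigminn_le _ (mem A) _ _ x xA) _.
  exact: (bigminn_le _ (mem B)).
suff: cond_diam G s < cond_diam G s by rewrite ltnn.
rewrite -[in X in _ < X](prednK D0) ltnS.
apply/bigmax_leqP => A cA; apply/bigmax_leqP => B cB.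
rewrite -ltnS (prednK D0) ltnNge; apply: contra none => le.
by apply/existsP; exists A; rewrite cA; apply/existsP; exists B; rewrite cB.
Qed.

(** * Existence of a fork *)

Lemma sum_excess_le1 m (F : 'I_m -> nat) : (forall i, 0 < F i) ->
  \sum_(i < m) F i <= m.+1 ->
  (forall i, F i <= 2) /\ (forall i j, i != j -> F i + F j <= 3).
Proof.
move=> F0 sF; have ex : \sum_(i < m) (F i).-1 <= 1.
  rewrite -(leq_add2r m) add1n -[X in _ + X]card_ord -sum1_card -big_split /=.
  by under eq_bigr => i _ do rewrite addn1 prednK //.
split=> [i|i j ij]; first by move: ex; rewrite (bigD1 i) //=; clear; lia.
move: ex; rewrite (bigD1 i) //= (bigD1 j) 1?eq_sym //=.
by move: (F0 i) (F0 j); clear; lia.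
Qed.

(** The configuration to which [dist_sum_fork] applies, with a and b at least [s]; the strict bound
    on [#|X|] reflects [#|X|] = a + 1. *)
Definition fork_at {G : sgraph} (s : nat) (r : G) (X : {set G}) :=
  [/\ branch r X, 1 < #|[set c in X | adj r c]|, s < #|X| &
      s <= #|~: (r |: X)|].

Lemma disjoint_leq_cardC {T : finType} (A B : {set T}) :
  [disjoint A & B] -> #|A| <= #|~: B|.
Proof. by move=> dAB; rewrite subset_leq_card // -disjoints_subset. Qed.

(* Otherwise X minus the only neighbour of r in X is at distance D + 1 from B. *)
Lemma fork_far_branch {G : sgraph} (r : G) (X B : {set G}) (f : G -> nat) s D :
  connected G -> D < #|G| -> cond_diam G s <= D -> branch r X ->
  s < #|X| -> s <= #|B| -> B \subset ~: (r |: X) ->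
  (forall u v, adj u v -> u \notin X -> v \notin X -> f v <= (f u).+1) ->
  (forall u, f u < #|G|) -> f r = 1 -> {in B, forall y, D <= f y} ->
  fork_at s r X.
Proof.
move=> cG DG cD bX sX sB BXc fL fG fr fB.
split=> //; last exact: leq_trans sB (subset_leq_card BXc).
rewrite ltnNge; apply/negP => N1; set N := [set c in X | _] in N1.
(* Outside [X] the function [f] is shifted by one. As [f r = 1] and only the vertices of [N] are
   adjacent to [r], [h] grows by at most one along edges. *)
pose h z := if z \in X :\: N then 0 else if z \in X then 1 else (f z).+1.
suff: D.+1 <= cond_diam G s by rewrite ltnNge cD.
apply: (@cond_diam_ge _ (X :\: N) B) => // [|x y xX yB].
  have NX : N \subset X by apply/subsetP => z; rewrite inE => /andP[].
  by rewrite cardsD (setIidPr NX); move: sX N1; clear; lia.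
have yX : y \notin X.
  by have := subsetP BXc _ yB; rewrite !inE negb_or => /andP[].
have hy : h y = (f y).+1 by rewrite /h inE (negPf yX) andbF.
have hx : h x = 0 by rewrite /h xX.
have := fB y yB; rewrite -ltnS -hy => /leq_trans; apply.
rewrite -(add0n (dist x y)) -hx; apply: dist_lipschitz; last by rewrite hx hy fG.
move=> u v uv; rewrite {1}/h; case: ifP => // _; case: ifP => // vX.
have [uX|uX] := boolP (u \in X); last first.
  by rewrite /h inE (negPf uX) andbF ltnS fL // vX.
have [_ /(_ u v uX uv)] := bX; rewrite in_setU1 vX orbF => /eqP vr.
by rewrite vr fr /h !inE uX -vr adj_sym uv.
Qed.

(** Three cases: all levels 1, ..., D - 1 are singletons; level 1 has two vertices; a later level
    has two. Where two neighbours of [r] are not given by the levels, [fork_far_branch] supplies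
    them. *)
Lemma fork_exists {G : sgraph} s n : 0 < s -> connected G -> #|G| = n ->
  2 * s + 3 <= n -> cond_diam G s = n - 2 * s ->
  exists r X, @fork_at G s r X.
Proof.
move=> s0 cG cn n3 cD; set D := n - 2 * s in cD.
have D3 : 2 < D by rewrite /D; lia.
have Dn : D < n by rewrite /D; lia.
have [|A [B [cA cB]]] := @cond_diam_attained G s; first by rewrite cD; lia.
rewrite cD => dAB.
have A0 : 0 < #|A| by rewrite cA.
have B0 : 0 < #|B| by rewrite cB.
pose l := level A.
have lA v : (l v == 0) = (v \in A) by apply: level_eq0.
have lB v : v \in B -> D <= l v.
  by move=> vB; rewrite /l; have [x xA ->] := level_attained A v cG A0; apply: dAB.
have ladj u v : adj u v -> l v <= (l u).+1 by apply: level_adj.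
have ladjV u v : adj u v -> l u <= (l v).+1 by rewrite adj_sym; apply: level_adj.
have ln v : l v < #|G| by apply: level_lt_card.
pose L j := [set v | l v == j].
have L0 j : j < D -> 0 < #|L j|.
  move=> jD; have /card_gt0P[b bB] := B0.
  have [|u lu] := level_inhabited A b j cG A0; first exact: ltnW (leq_trans jD (lB b bB)).
  by apply/card_gt0P; exists u; rewrite inE /l lu.
pose Z := [set v | D <= l v].
have BZ : B \subset Z by apply/subsetP => v vB; rewrite inE lB.
have sumL : s + \sum_(j < D.-1) #|L j.+1| + #|Z| = n.
  have sumlt k : \sum_(j < k) #|L j| = #|[set v | l v < k]|.
    elim: k => [|k IH].
      by rewrite big_ord0; apply/esym/eqP; rewrite cards_eq0; apply/eqP/setP=> v; rewrite !inE.
    rewrite big_ord_recr /= IH -cardsUI addnC (_ : _ :&: _ = set0).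
      rewrite cards0; apply: eq_card => v; rewrite !inE ltnS; by clear; lia.
    by apply/setP => v; rewrite !inE; clear; lia.
  have LA : L 0 = A by apply/setP => v; rewrite inE lA.
  have -> : s + \sum_(j < D.-1) #|L j.+1| = #|[set v | l v < D]|.
    by rewrite -[in RHS](prednK (ltnW (ltnW D3))) -sumlt big_ord_recl LA cA.
  rewrite -cn -(cardsC [set v | l v < D]); congr (_ + _).
  by apply: eq_card => v; rewrite !inE leqNgt.
(* As [Z] contains [B], it has at least [s] vertices, so these D - 1 nonempty levels share at most D
   vertices. *)
have [Lle2 Lle3] : (forall i : 'I_D.-1, #|L i.+1| <= 2) /\
    (forall i j : 'I_D.-1, i != j -> #|L i.+1| + #|L j.+1| <= 3).
  apply: (@sum_excess_le1 D.-1 (fun i => #|L i.+1|)).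
    by move=> i; apply: L0; have := ltn_ord i; clear; lia.
  by have := subset_leq_card BZ; rewrite cB; move: sumL D3; rewrite /D; clear; lia.
have inL j v : l v = j -> v \in L j by move=> <-; rewrite inE.
have disjA j (Y : {set G}) : 0 < j -> {in Y, forall y, j <= l y} -> [disjoint A & Y].
  move=> j0 Yj; apply/pred0P => v /=; apply/negbTE/negP => /andP[vA /Yj].
  by move: vA; rewrite -lA => /eqP->; rewrite leqNgt j0.
have [i Li2|L1] := pickP (fun i : 'I_D.-1 => #|L i.+1| == 2); last first.
  (* If no level has two vertices, the spare vertex lies in [Z], which then has s + 1 vertices and
     is a branch at the vertex of level D - 1. *)
  have Lle1 (i : 'I_D.-1) : #|L i.+1| = 1.
    have := Lle2 i; have := L1 i; have := L0 i.+1.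
    by have := ltn_ord i; move: D3 #|L i.+1|; clear; lia.
  have cZ : #|Z| = s.+1.
    move: sumL; rewrite (eq_bigr (fun=> 1)) => [|i _]; last exact: Lle1.
    by rewrite sum1_card card_ord; move: n3; rewrite /D; clear; lia.
  have D1 : D.-2 < D.-1 by move: D3; clear; lia.
  have D2 : D.-2.+1 = D.-1 by move: D3; clear; lia.
  have Dr : 0 < D.-1 by rewrite -D2.
  have /eqP/cards1P[r] := Lle1 (Ordinal D1); rewrite /= D2 => Lr.
  have lr : l r = D.-1 by apply/eqP; have := set11 r; rewrite -Lr inE.
  (* Here the far set is [A], so the levels are read backwards: [D - l z] is 1 at [r] and D on
     [A]. *)
  exists r, Z; apply: (@fork_far_branch G r Z A (fun z => D - l z) s D) => //.
  + by rewrite cn.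
  + by rewrite cD.
  + split=> [|x y]; first by rewrite inE lr; move: D3; clear; lia.
    rewrite !inE => lx xy; have := leq_trans lx (ladjV _ _ xy).
    rewrite -{1}(prednK (ltnW (ltnW D3))) ltnS leq_eqVlt => /predU1P[/esym/inL|].
      by rewrite Lr inE => ->.
    by rewrite (prednK (ltnW (ltnW D3))) => ->; rewrite orbT.
  + by rewrite cZ.
  + by rewrite cA.
  + rewrite -disjoints_subset (disjA D.-1) // => y; rewrite !inE.
    by case/predU1P=> [->|/(leq_trans (leq_pred _)) //]; rewrite lr.
  + by move=> u v /ladjV; clear; lia.
  + by move=> u; rewrite cn; move: Dn; clear; lia.
  + by rewrite lr; move: D3; clear; lia.
  by move=> y; rewrite -lA => /eqP->; rewrite subn0.
(* If level 1 is the double one, level 2 is a single vertex [t], since D is at least 3. *)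
case: (posnP i) => [i0|i0].
  have i1 : 1 < D.-1 by move: D3; clear; lia.
  have Li1 : #|L 2| == 1.
    rewrite eqn_leq L0 // andbT; have := Lle3 i (Ordinal i1).
    by rewrite -val_eqE /= (eqP Li2) i0 => /(_ isT).
  move: Li2; rewrite i0 => /cards2P[u [v [uv Luv]]].
  have /cards1P[t Lt] := Li1.
  have lt : l t = 2 by apply/eqP; have := set11 t; rewrite -Lt inE.
  have lu : l u = 1 by apply/eqP; have := set21 u v; rewrite -Luv inE.
  have lv : l v = 1 by apply/eqP; have := set22 u v; rewrite -Luv inE.
  (* If [t] sees both vertices of level 1, it is the fork, with levels 0 and 1 as branch. *)
  have [/andP[tu tv]|] := boolP (adj t u && adj t v).
    exists t, [set x | l x < 2]; split.
    + split=> [|x y]; first by rewrite inE lt.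
      rewrite !inE => lx xy; have := leq_trans (ladj _ _ xy) lx.
      rewrite leq_eqVlt => /predU1P[/inL|->]; last by rewrite orbT.
      by rewrite Lt inE => ->.
    + by apply/card_gt1P; exists u, v; rewrite !inE lu lv tu tv.
    + have uA : u \notin A by rewrite -lA lu.
      rewrite -cA -[_.+1]/(true + #|A|) -uA -cardsU1 subset_leq_card //.
      rewrite subUset sub1set inE lu /=; apply/subsetP => x.
      by rewrite -lA inE => /eqP->.
    rewrite -cB disjoint_leq_cardC //; apply/pred0P => x /=; apply/negbTE.
    apply/negP => /andP[/lB Dx]; rewrite !inE => /predU1P[xt|].
      by move: Dx; rewrite xt lt leqNgt D3.
    by rewrite ltnNge (leq_trans (ltnW D3) Dx).
  (* Otherwise [t] misses one of them, say [v]. All neighbours of [v] then lie in [A] or equal [u],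
     so [A] with [v] is a branch at [u]. *)
  rewrite negb_and => ntuv; wlog tv : u v uv Luv lu lv ntuv / ~~ adj t v.
    move=> W; case/orP: (ntuv) => [tu|tv]; last exact: (W u v).
    by apply: (W v u); rewrite // 1?eq_sym // 1?setUC // orbC.
  have vA : v \notin A by rewrite -lA lv.
  have bX : branch u (v |: A).
    split=> [|x y]; first by rewrite !inE (negPf uv) -lA lu.
    move=> xX xy; have ly : l y <= 1.
      case/setU1P: xX xy => [->|].
        move=> vy; have := ladj _ _ vy; rewrite lv leq_eqVlt => /predU1P[/inL|//].
        by rewrite Lt inE => /eqP yt; rewrite -yt adj_sym vy in tv.
      by rewrite -lA => /eqP lx /ladj; rewrite lx.
    move: ly; rewrite leq_eqVlt ltnS leqn0 lA !inE => /predU1P[/inL|->].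
      by rewrite Luv !inE orbA => ->.
    by rewrite !orbT.
  exists u, (v |: A); apply: (@fork_far_branch G u (v |: A) B l s D) => //.
  + by rewrite cn.
  + by rewrite cD.
  + by rewrite cardsU1 vA cA.
  + by rewrite cB.
  + apply/subsetP => b /lB Db; rewrite !inE !negb_or -lA.
    by apply/and3P; split; apply: contraTneq Db => ->; rewrite ?lu ?lv -ltnNge; move: D3; clear; lia.
  by move=> x y /ladj.
(* In the last case level [i] is a single vertex [r] above level 0, and both vertices of level
   [i.+1] have it as their neighbour in the preceding level. *)
have iD : i.+1 < D by have := ltn_ord i; move: D3; clear; lia.
have i1 : i.-1 < D.-1 by have := ltn_ord i; clear; lia.
have Li1 : #|L i| == 1.
  rewrite eqn_leq L0 ?(ltnW iD) // andbT.
  have := Lle3 i (Ordinal i1); rewrite /= prednK // (eqP Li2).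
  by rewrite -val_eqE /= => /(_ _); move: i0; clear; lia.
have /cards1P[r Lr] := Li1.
have lr : l r = i by apply/eqP; have := set11 r; rewrite -Lr inE.
pose X := [set v | i < l v]; exists r, X; split.
- split=> [|x y]; first by rewrite inE lr ltnn.
  rewrite !inE => lx xy; have := leq_trans lx (ladjV _ _ xy).
  rewrite ltnS leq_eqVlt => /predU1P[/esym/inL|->]; last by rewrite orbT.
  by rewrite Lr inE => ->.
- rewrite -(eqP Li2) subset_leq_card //; apply/subsetP => c.
  rewrite !inE => /eqP lc; rewrite lc leqnn /=.
  by have [u uc /inL] := level_pred A c i cG A0 lc; rewrite Lr inE => /eqP<-.
- have /card_gt0P[c] : 0 < #|L i.+1| by rewrite (eqP Li2).
  rewrite inE => /eqP lc; have cB' : c \notin B.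
    by apply: contraL iD => /lB; rewrite lc -leqNgt.
  rewrite -cB -[_.+1]/(true + #|B|) -cB' -cardsU1 subset_leq_card // subUset sub1set inE lc leqnn.
  by apply/subsetP => b /lB; rewrite inE; apply: leq_trans; exact: ltnW.
rewrite -cA disjoint_leq_cardC // (disjA i) // => y; rewrite !inE.
by case/predU1P=> [->|/ltnW //]; rewrite lr.
Qed.

(** * The bound on the Wiener index and its equality case *)

Theorem theorem3p2 (s n : nat) (G : sgraph) :
  0 < s -> connected G -> #|G| = n -> 2 * s + 3 <= n ->
  cond_diam G s = n - 2 * s ->
  wiener G <= wiener (tree n s.+1) /\
  (wiener G = wiener (tree n s.+1) <-> isomorphic G (tree n s.+1)).
Proof.
move=> s0 cG cn n3 cD.
have [r [X [bX /card_gt1P[c1 [c2 [c1X c2X c12]]] sX sY]]] :=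
  fork_exists s n s0 cG cn n3 cD.
move: c1X c2X; rewrite !inE => /andP[c1X rc1] /andP[c2X rc2].
have [rX _] := bX.
have [x cX] : exists x, #|X| = (s + x).+1.
  by exists (#|X| - s.+1); rewrite -addSn subnKC.
have [y cY] : exists y, #|~: (r |: X)| = s + y.
  by exists (#|~: (r |: X)| - s); rewrite subnKC.
have nE : n = s + x + (s + y) + 2.
  by rewrite -cn -(cardsC (r |: X)) cardsU1 rX cX cY; clear; lia.
have := dist_sum_fork r c1 c2 X _ _ cG bX c1X c2X c12 rc1 rc2 cX cY.
rewrite -nE => -[leG eqG]; have := tree_dist_sum_ge n s.
have -> : n - 2 - s = s + x + y by rewrite nE; clear; lia.
have sn : s.+2 <= n by move: n3; clear; lia.
move=> /(_ sn) geT.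
(* With a = s + x and b = s + y, the product ab exceeds s(n - 2 - s) by exactly xy; equality of the
   Wiener indices therefore forces xy = 0. *)
have xy : (s + x) * (s + y) = s * (s + x + y) + x * y by clear; lia.
rewrite xy in leG eqG.
split; first by move: leG geT; rewrite !dist_sum_wiener; clear; lia.
split=> [eqW|/isomorphic_dist_sum]; last by rewrite !dist_sum_wiener; clear; lia.
have eqS : dist_sum G = dist_sum (tree n s.+1) by rewrite !dist_sum_wiener eqW.
have xy0 : x * y = 0 by move: leG geT; rewrite eqS; clear; lia.
have [||w [p [q [rw rp rq uz [szp szq]]]]] := eqG.
- by rewrite addn_gt0 s0.
- by move: leG geT; rewrite eqS; clear; lia.
suff [g bg gadj] : exists2 g : tree n s.+1 -> G, bijective g &
    forall u v, adj u v -> adj (g u) (g v) by exact: dist_sum_embed_iso bg gadj eqS.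
(* An arm of length exactly [s] takes the place of the first [s] path vertices: [q] if x = 0, [p] if
   y = 0. *)
move/eqP: xy0; rewrite muln_eq0 => /orP[/eqP xE|/eqP yE].
  apply: (tree_spanning n s w r p q) => //; first by rewrite szq xE addn0.
  by rewrite szp nE xE; clear; lia.
apply: (tree_spanning n s w r q p) => //; last first.
- by rewrite szq nE yE; clear; lia.
- by rewrite szp yE addn0.
by move: uz; rewrite /= !mem_cat !inE !mem_cat [(w \in q) || _]orbC [(r \in q) || _]orbC uniq_catC.
Qed.
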